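(* Let $(\Omega,\mathcal{A},\mathbb{P})$ be a probability space and $\mathcal{D}$ a finite index set (the set of dimensions). Let $L$ be a real-valued loss function of the parameter vector $(\theta(d))_{d\in\mathcal D}$ admitting first-order partial derivatives, let $f:\mathbb{R}\to\mathbb{R}$ be any function, and for each $d\in\mathcal D$ let $\gamma(d)\in\mathbb{R}$ be a constant. Let $(\theta_t(d))_{t\ge 0,\,d\in\mathcal D}$ be real-valued random variables, let $\mathfrak F_t$ be the $\sigma$-algebra generated by $(\theta_s(d))_{0\le s\le t,\,d\in\mathcal D}$, and write $g_t(d)=\frac{\partial L_t}{\partial\theta_t(d)}$ for the partial derivative of $L$ along dimension $d$ evaluated at $(\theta_t(d'))_{d'\in\mathcal D}$. Assume that for all $t=0,1,2,\dots$ and all $d\in\mathcal D$, $$\theta_{t+1}(d)=\theta_t(d)-\gamma(d)\,f(g_t(d))+\sigma_t(d)\,\epsilon_{t+1}(d),$$ where: (i) the random variables $\epsilon_{t+1}(d)$ satisfy $\mathbb E[\epsilon_{t+1}(d)]=0$ and $\mathbb E[\epsilon_{t+1}(d)^2]=e(d)<\infty$ with $e(d)$ independent of $t$, and $\epsilon_{t+1}(d)$ is independent of $\mathfrak F_t$; (ii) for every $d$, $g_t(d)\neq 0$ for all but finitely many $t$; (iii) $\sigma_t(d)=\min\big(c_t(d),|f(g_t(d))|\big)$ if $g_t(d)\neq0$ and $\sigma_t(d)=c_t(d)$ otherwise, where $(c_t(d))_{t\ge0}$ is an $(\mathfrak F_t)$-adapted process with $c_t(d)>0$; (iv) $|f(g_t(d))|\le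 |b_t(d)|$ for all $t$, for some $(\mathfrak F_t)$-adapted process $(b_t(d))_{t\ge0}$ with $\sum_{s=1}^\infty\big(c_s(d)^{-1}b_s(d)/s\big)^2<\infty$; (v) $(k_t(d))_{t\ge0}$ and $(k'_t(d))_{t\ge0}$ are $(\mathfrak F_t)$-adapted processes such that $k_t(d)+\sum_{s=0}^t\big(\sigma_s(d)^{-1}f(g_s(d))\big)^2\neq0$ for all $t$ and $\lim_{t\to\infty}k'_t(d)/t=\lim_{t\to\infty}k_t(d)/t=0$. Define, with $\Delta^{(\theta)}_s(d)=\theta_{s+1}(d)-\theta_s(d)$, $$\hat\gamma_{t+1}(d)=\frac{k'_t(d)-\sum_{s=0}^t\sigma_s(d)^{-2}f(g_s(d))\,\Delta^{(\theta)}_s(d)}{k_t(d)+\sum_{s=0}^t\big(\sigma_s(d)^{-1}f(g_s(d))\big)^2}.$$ Then for every $d\in\mathcal D$, $\lim_{t\to\infty}\hat\gamma_{t+1}(d)=\gamma(d)$.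
   Context: All equalities, inequalities and limits involving random variables are understood to hold almost surely. An $(\mathfrak F_t)$-adapted process is one whose value at time $t$ is $\mathfrak F_t$-measurable.
   Formalization: The formal theorem assumes f is Borel measurable (for arbitrary f the claim can fail) and that σ_t(d) ≠ 0 for all t almost surely, without which σ_t(d)^{-1} is undefined; F_t-measurability of g_t(d) is also stated as a hypothesis. *)

(* Defs.v *)
From HB Require Import structures.
From mathcomp Require Import all_boot all_order all_algebra.
From mathcomp Require Import all_classical all_reals all_analysis.
Set Implicit Arguments. Unset Strict Implicit. Unset Printing Implicit Defensive.
Import Order.TTheory GRing.Theory Num.Theory.
Import numFieldNormedType.Exports.
Local Open Scope classical_set_scope.
Local Open Scope ring_scope.

Definition upd {D : finType} {R : Type} (x : D -> R) (d : D) (v : R) : D -> R :=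
  fun d' => if d' == d then v else x d'.

Definition partial {R : realType} {D : finType} (L : (D -> R) -> R) (d : D)
  (x : D -> R) : R :=
  derive1 (fun v : R => L (upd x d v)) (x d).

Definition gen_filtration {dT} {T : measurableType dT} {R : realType} {D : finType}
  (theta : nat -> D -> T -> R) (t : nat) : set (set T) :=
  <<s \bigcup_(s in [set s : nat | (s <= t)%N])
        \bigcup_(d in [set: D])
          preimage_set_system setT (theta s d) (@measurable _ R) >>.

Definition measurable_wrt {T : Type} {R : realType} (F : set (set T)) (X : T -> R) :=
  forall B : set R, measurable B -> F (X @^-1` B).

Definition indep_of {dT} {T : measurableType dT} {R : realType}
  (P : probability T R) (X : T -> R) (F : set (set T)) :=
  forall (A : set T) (B : set R), F A -> measurable B ->
    P (A `&` X @^-1` B) = (P A * P (X @^-1` B))%E.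

Definition sigma_of {R : realType} (f : R -> R) (c g : R) : R :=
  if g != 0 then Num.min c `|f g| else c.

(* estimator hat(gamma)_{t+1}(d) at a fixed outcome *)
Definition gamma_hat {R : realType} (f : R -> R)
  (th g sig k k' : nat -> R) (t : nat) : R :=
  (k' t - \sum_(s < t.+1) ((sig s) ^- 2 * f (g s) * (th s.+1 - th s)))
  / (k t + \sum_(s < t.+1) ((sig s)^-1 * f (g s)) ^+ 2).

(* Main.v *)
(** Put [u_s = f(g_s)/sigma_s] and [M_t = sum_(s <= t) u_s * eps_(s+1)].  The
    recursion gives [gamma_hat - gamma = (k' - gamma * k - M) / (k + sum u_s^2)].
    Since [|u_s| >= 1] as soon as [g_s != 0], the denominator grows at least
    linearly, so it suffices that [M_t / t -> 0] almost surely.  As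
    [u_s^2 <= 1 + (b_s/c_s)^2], the predictable weights [v_s = u_s/(s+1)] are
    almost surely square summable, so the martingale transform
    [sum v_s * eps_(s+1)] converges almost surely, and Kronecker's lemma
    concludes.  The convergence rests on a Kolmogorov maximal inequality obtained
    by stopping the transform when it reaches level [a]; its second moment is
    computed in extended reals by Tonelli alone, so no integrability of the
    weights is needed. *)

Require Import Defs.
From HB Require Import structures.
From mathcomp Require Import all_boot all_order all_algebra.
From mathcomp Require Import all_classical all_reals all_analysis.
From mathcomp Require Import measurable_realfun ring lra.
Set Implicit Arguments.
Unset Strict Implicit.
Unset Printing Implicit Defensive.
Import Order.TTheory GRing.Theory Num.Theory.
Import numFieldNormedType.Exports.
Local Open Scope classical_set_scope.
Local Open Scope ring_scope.

(** * Independence and second moments in extended reals *)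

(** Independence says that the joint law of [(Y, Z)] agrees with the product of the marginal laws on
    rectangles, hence everywhere; Tonelli then splits the integral. *)
Lemma ge0_integral_indep d d1 d2 (T : measurableType d)
  (T1 : measurableType d1) (T2 : measurableType d2) (R : realType)
  (P : probability T R) (Y : {mfun T >-> T1}) (Z : {mfun T >-> T2})
  (h : T1 * T2 -> \bar R) :
  (forall A B, measurable A -> measurable B ->
    P (Y @^-1` A `&` Z @^-1` B) = (P (Y @^-1` A) * P (Z @^-1` B))%E) ->
  measurable_fun setT h -> (forall x, 0 <= h x)%E ->
  (\int[P]_w h (Y w, Z w) = \int[P]_w \int[P]_w' h (Y w, Z w'))%E.
Proof.
move=> indYZ mh h0.
have mYZ : measurable_fun setT (fun w => (Y w, Z w)).
  by apply: measurable_fun_pair.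
pose YZ : {mfun T >-> (T1 * T2)%type} := mfun_Sub (mem_set mYZ).
rewrite -[LHS](ge0_integral_distribution YZ mh)//.
have distE : forall A, measurable A ->
    (distribution P Y \x distribution P Z)%E A = distribution P YZ A.
  apply: product_measure_unique => A B mA mB.
  exact: indYZ.
rewrite (eq_measure_integral (distribution P Y \x distribution P Z)%E); last first.
  by move=> A mA _; apply/esym; exact: distE.
rewrite fubini_tonelli1// ge0_integral_distribution//; last 2 first.
- exact: measurable_fun_fubini_tonelli_F.
- by move=> y; apply: integral_ge0.
apply: eq_integral => w _ /=; rewrite /fubini_F ge0_integral_distribution//.
exact: measurableT_comp.
Qed.

Lemma sub_sigma_measurable_fun d (T : measurableType d) (R : realType)
    (H K : set (set T)) (X : T -> R) :
  <<s H >> `<=` <<s K >> ->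
  measurable_fun [set: g_sigma_algebraType H] X ->
  measurable_fun [set: g_sigma_algebraType K] X.
Proof. by move=> HK mX _ B mB; apply: HK; exact: mX. Qed.

Lemma sigma_measurable_fun d (T : measurableType d) (R : realType)
    (H : set (set T)) (X : T -> R) :
  <<s H >> `<=` @measurable _ T ->
  measurable_fun [set: g_sigma_algebraType H] X -> measurable_fun [set: T] X.
Proof. by move=> HT mX _ B mB; apply: HT; exact: mX. Qed.

Section second_moment.
Local Open Scope ereal_scope.
Context d (T : measurableType d) (R : realType) (P : probability T R).

(** Expanding the square, the cross term vanishes because [Z] is centred. The finite second moment
    makes each of the three terms integrable. *)
Lemma integral_affine_sqr (Z : T -> R) (x v e : R) :
  measurable_fun setT Z -> P.-integrable setT (EFin \o Z) ->
  'E_P[Z] = 0 -> 'E_P[fun w => (Z w ^+ 2)%R] = e%:E ->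
  \int[P]_w ((x + v * Z w) ^+ 2)%:E = (x ^+ 2)%:E + e%:E * (v ^+ 2)%:E.
Proof.
move=> mZ iZ; rewrite !unlock => EZ EZ2.
have iZ2 : P.-integrable setT (fun w => (Z w ^+ 2)%:E).
  apply/integrableP; split.
    by apply/measurable_EFinP; exact: measurable_funX.
  under eq_integral do rewrite gee0_abs ?lee_fin ?sqr_ge0//.
  by rewrite EZ2 ltry.
under eq_integral => w _.
  rewrite (_ : ((x + v * Z w) ^+ 2)%:E =
    ((x ^+ 2)%:E + (2 * x * v)%:E * (Z w)%:E) + (v ^+ 2)%:E * (Z w ^+ 2)%:E);
    last by rewrite -!EFinM -!EFinD; congr EFin; ring.
  over.
have icst : P.-integrable setT (fun=> (x ^+ 2)%:E).
  exact: finite_measure_integrable_cst.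
have i1 : P.-integrable setT (fun w => (2 * x * v)%:E * (Z w)%:E).
  exact: integrableZl.
rewrite integralD//; last 2 first.
- exact: integrableD.
- exact: integrableZl.
rewrite integralD// !integralZl// EZ EZ2 integral_cst//=.
rewrite probability_setT.
by rewrite mule0 adde0 mule1 muleC.
Qed.

(** Orthogonality of a martingale increment. Independence lets [Z] be integrated first with [(X, V)]
    frozen, which removes the cross term before [X] or [V] is integrated; the identity therefore
    makes sense even when both sides are infinite. *)
Lemma integral_step_sqr (G : set (set T)) (X V : g_sigma_algebraType G -> R)
    (Z : T -> R) (e : R) :
  <<s G >> `<=` @measurable _ T ->
  measurable_fun setT X -> measurable_fun setT V ->
  measurable_fun [set: T] Z -> P.-integrable setT (EFin \o Z) ->
  'E_P[Z] = 0 -> 'E_P[fun w => (Z w ^+ 2)%R] = e%:E ->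
  indep_of P Z <<s G >> ->
  \int[P]_w ((X w + V w * Z w) ^+ 2)%:E =
  \int[P]_w (X w ^+ 2)%:E + e%:E * \int[P]_w (V w ^+ 2)%:E.
Proof.
move=> GT mX mV mZ iZ EZ EZ2 indZ.
have mT (Y : T -> R) := @sigma_measurable_fun _ _ _ _ Y GT.
have mXV : measurable_fun [set: g_sigma_algebraType G] (fun w => (X w, V w)).
  by apply: measurable_fun_pair.
have mXVT : measurable_fun [set: T] (fun w => (X w, V w)).
  by apply: measurable_fun_pair; exact: mT.
pose XV : {mfun T >-> (R * R)%type} := mfun_Sub (mem_set mXVT).
pose Z' : {mfun T >-> R} := mfun_Sub (mem_set mZ).
pose h (p : R * R * R) := ((p.1.1 + p.1.2 * p.2) ^+ 2)%:E.
have -> : \int[P]_w ((X w + V w * Z w) ^+ 2)%:E = \int[P]_w h (XV w, Z' w) by [].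
rewrite ge0_integral_indep//; last 3 first.
- move=> A B mA mB; apply: indZ => //.
  by rewrite -[X in <<s G >> X]setTI; exact: mXV.
- apply/measurable_EFinP; apply: measurable_funX; apply: measurable_funD.
    by apply: measurableT_comp.
  by apply: measurable_funM => //; exact: measurableT_comp.
- by move=> x; rewrite lee_fin sqr_ge0.
under eq_integral do rewrite (integral_affine_sqr _ _ mZ iZ EZ EZ2).
have e0 : (0 <= e)%R.
  rewrite -lee_fin -EZ2 unlock; apply: integral_ge0 => w _.
  by rewrite lee_fin sqr_ge0.
have mXT := mT _ mX; have mVT := mT _ mV.
rewrite ge0_integralD//; last 4 first.
- by move=> w _; rewrite lee_fin sqr_ge0.
- by apply/measurable_EFinP; exact: measurable_funX.
- by move=> w _; rewrite -EFinM lee_fin mulr_ge0 ?sqr_ge0.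
- apply: measurable_funeM; apply/measurable_EFinP; exact: measurable_funX.
rewrite ge0_integralZl//.
- by apply/measurable_EFinP; exact: measurable_funX.
- by move=> w _; rewrite lee_fin sqr_ge0.
Qed.

End second_moment.

(* Index convention: [eps n] stands for the paper's epsilon_{n+1}, hence is
   measurable at time [n.+1] and independent of time [n]. *)
Record noise d (T : measurableType d) (R : realType) (P : probability T R)
    (G : nat -> set (set T)) (eps : nat -> T -> R) (e : R) : Prop := {
  noise_sub : forall n, <<s G n >> `<=` @measurable _ T ;
  noise_mono : forall n, <<s G n >> `<=` <<s G n.+1 >> ;
  noise_measurable : forall n,
    measurable_fun [set: g_sigma_algebraType (G n.+1)] (eps n) ;
  noise_integrable : forall n, P.-integrable setT (EFin \o eps n) ;
  noise_mean : forall n, ('E_P[eps n] = 0)%E ;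
  noise_sqr : forall n, ('E_P[fun w => (eps n w ^+ 2)%R] = e%:E)%E ;
  noise_indep : forall n, indep_of P (eps n) <<s G n >> }.

Lemma measure_bigcup_le d (T : measurableType d) (R : realType)
    (mu : {measure set T -> \bar R}) (A : nat -> set T) (c : \bar R) :
  (forall n, measurable (A n)) -> nondecreasing_seq A ->
  (forall n, mu (A n) <= c)%E -> (mu (\bigcup_n A n) <= c)%E.
Proof.
move=> mA ndA muAc.
have cvA := nondecreasing_cvg_mu (mu := mu) mA (bigcupT_measurable A mA) ndA.
rewrite -(cvg_lim _ cvA)//; apply: lime_le; last exact: nearW.
by apply/cvg_ex; eexists; exact: cvA.
Qed.

(** * Kolmogorov's maximal inequality by stopping *)

Section maximal.
Context d (T : measurableType d) (R : realType) (P : probability T R).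
Variables (G : nat -> set (set T)) (eps : nat -> T -> R) (e : R).

(* The transform [sum v_s * eps_s], frozen once it leaves the interval ]-a, a[. *)
Fixpoint stopped_sum (v : nat -> T -> R) (a : R) (n : nat) (w : T) : R :=
  if n is n'.+1 then
    stopped_sum v a n' w
    + (if `|stopped_sum v a n' w| < a then v n' w else 0) * eps n' w
  else 0.

Lemma stopped_sum_stop v a n m w : (n <= m)%N ->
  a <= `|stopped_sum v a n w| -> stopped_sum v a m w = stopped_sum v a n w.
Proof.
move=> /subnKC <- an; elim: (m - n)%N => [|k IH]; first by rewrite addn0.
by rewrite addnS /= IH ltNge an /= mul0r addr0.
Qed.

(** A sum that is still below [a] at time [n] was never frozen before, since freezing is
    permanent. *)
Lemma stopped_sumE v a n w : `|stopped_sum v a n w| < a ->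
  forall m, (m <= n)%N -> stopped_sum v a m w = \sum_(s < m) v s w * eps s w.
Proof.
move=> na; elim=> [|m IH] mn; first by rewrite big_ord0.
have ma : `|stopped_sum v a m w| < a.
  rewrite ltNge; apply/negP => am; have := stopped_sum_stop (ltnW mn) am.
  by move=> H; move: na; rewrite H ltNge am.
by rewrite /= ma IH ?(ltnW mn)// big_ord_recr.
Qed.

Hypothesis noise_eps : noise P G eps e.

Lemma stopped_sum_measurable (v : nat -> T -> R) a :
  (forall n, measurable_fun [set: g_sigma_algebraType (G n)] (v n)) ->
  forall n, measurable_fun [set: g_sigma_algebraType (G n)] (stopped_sum v a n).
Proof.
move=> mv; elim=> [|n IH] /=; first exact: measurable_cst.
have mono := noise_mono noise_eps (n := n).
apply: measurable_funD; first exact: sub_sigma_measurable_fun IH.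
apply: measurable_funM; last exact: noise_measurable noise_eps _.
apply: sub_sigma_measurable_fun mono _.
apply: measurable_fun_ifT => //.
by apply: measurable_fun_ltr => //; exact: measurableT_comp.
Qed.

Lemma noise_sqr_ge0 : 0 <= e.
Proof.
rewrite -lee_fin -(noise_sqr noise_eps 0%N) unlock; apply: integral_ge0 => w _.
by rewrite lee_fin sqr_ge0.
Qed.

(** Each step adds [e] times the second moment of the stopped weight; stopping replaces [v n] by 0
    or keeps it, so it can only lower that moment. *)
Lemma integral_stopped_sum_sqr (v : nat -> T -> R) a n :
  (forall n, measurable_fun [set: g_sigma_algebraType (G n)] (v n)) ->
  (\int[P]_w (stopped_sum v a n w ^+ 2)%:E
   <= e%:E * \int[P]_w (\sum_(s < n) v s w ^+ 2)%:E)%E.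
Proof.
move=> mv; have e0 := noise_sqr_ge0.
have mvT n' := sigma_measurable_fun (noise_sub noise_eps (n := n')) (mv n').
have mvT2 s : measurable_fun setT (fun w => (v s w ^+ 2)%:E).
  by apply/measurable_EFinP; exact: measurable_funX.
elim: n => [|n IH].
  rewrite [leLHS]integral0_eq; last by move=> w _; rewrite expr0n.
  rewrite mule_ge0 ?lee_fin//; apply: integral_ge0 => w _.
  by rewrite lee_fin sumr_ge0// => i _; exact: sqr_ge0.
have mSn := stopped_sum_measurable a mv (n:=n).
have mb : measurable_fun [set: g_sigma_algebraType (G n)]
    (fun w => if `|stopped_sum v a n w| < a then v n w else 0).
  apply: measurable_fun_ifT => //.
  by apply: measurable_fun_ltr => //; exact: measurableT_comp.
rewrite /= (integral_step_sqr (noise_sub noise_eps (n := n)) mSn mb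
  _ (noise_integrable noise_eps n) (noise_mean noise_eps n)
  (noise_sqr noise_eps n) (noise_indep noise_eps (n:=n))); last first.
  exact: sigma_measurable_fun (noise_sub noise_eps (n := n.+1))
    (noise_measurable noise_eps (n:=n)).
under [in leRHS]eq_integral do rewrite big_ord_recr/= EFinD.
rewrite ge0_integralD//=; last 3 first.
- by move=> w _; rewrite lee_fin sumr_ge0// => i _; exact: sqr_ge0.
- apply/measurable_EFinP; apply: measurable_sum => s; exact: measurable_funX.
- by move=> w _; rewrite lee_fin sqr_ge0.
rewrite [leRHS]ge0_muleDr; last 2 first.
- apply: integral_ge0 => w _.
  by rewrite lee_fin sumr_ge0// => i _; exact: sqr_ge0.
- by apply: integral_ge0 => w _; rewrite lee_fin sqr_ge0.
apply: leeD => //; apply: lee_wpmul2l; first by rewrite lee_fin.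
have mbT := sigma_measurable_fun (noise_sub noise_eps (n := n)) mb.
apply: ge0_le_integral => //.
- by move=> w _; rewrite lee_fin sqr_ge0.
- by apply/measurable_EFinP; exact: measurable_funX.
- move=> w _; rewrite lee_fin.
  by case: ifP => // _; rewrite expr0n sqr_ge0.
Qed.

(** After stopping, the events of being at level [a] or above at time [n] increase with [n], and
    their union is the event that the original sums ever reach [a]. A Chebyshev bound uniform in [n]
    thus passes to the union. *)
Lemma noise_maximal_inequality (v : nat -> T -> R) (a delta : R) :
  (forall n, measurable_fun [set: g_sigma_algebraType (G n)] (v n)) ->
  (forall n w, \sum_(s < n) v s w ^+ 2 <= delta) -> 0 < a ->
  (P [set w | exists n, (a <= `|\sum_(s < n) v s w * eps s w|)%R]
   <= (e * delta / a ^+ 2)%:E)%E.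
Proof.
move=> mv vdelta a0; have e0 := noise_sqr_ge0.
have mS n : measurable_fun [set: T] (stopped_sum v a n).
  exact: sigma_measurable_fun (noise_sub noise_eps (n := n))
    (stopped_sum_measurable a mv (n := n)).
pose A n := [set w | a <= `|stopped_sum v a n w|].
have mA n : measurable (A n).
  rewrite -[A n]setTI; apply: measurable_fun_le => //.
  by apply: measurableT_comp.
have -> : [set w | exists n, (a <= `|\sum_(s < n) v s w * eps s w|)%R]
    = \bigcup_n A n.
  apply/seteqP; split => w /=.
    move=> [n an]; exists n => //=; rewrite /A /= leNgt; apply/negP => na.
    by move: an; rewrite -(stopped_sumE na (leqnn n)) leNgt na.
  move=> [n _ An]; have ex : exists n, a <= `|stopped_sum v a n w| by exists n.
  (* The first passage time is some [m.+1], because the sum starts at 0. At time [m] the sum is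
     below [a], so its next increment is not frozen and the original sum passes too. *)
  case: (ex_minnP ex) => -[|m] /=; first by rewrite normr0 leNgt a0.
  move=> am minm; exists m.+1.
  have ma : `|stopped_sum v a m w| < a.
    by rewrite ltNge; apply/negP => /minm; rewrite ltnn.
  move: am; rewrite ma big_ord_recr/=.
  by rewrite (stopped_sumE ma (leqnn m)).
apply: measure_bigcup_le => //.
  move=> m n mn; apply/subsetPset => w; rewrite /A /= => am.
  by rewrite (stopped_sum_stop mn am).
move=> n; rewrite mulrC EFinM lee_pdivlMl ?exprn_gt0//.
have a2 : 0 < a ^+ 2 by rewrite exprn_gt0.
have mS2 : measurable_fun setT (fun w => (stopped_sum v a n w ^+ 2)%:E).
  by apply/measurable_EFinP; exact: measurable_funX.
(* Markov's inequality for the square at level [a ^+ 2]. *)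
have := le_integral_abse P measurableT mS2 a2.
have -> : [set: T] `&`
    [set w | ((a ^+ 2)%:E <= `|(stopped_sum v a n w ^+ 2)%:E|)%E] = A n.
  rewrite setTI; apply/seteqP; split => w /=; rewrite /A/= lee_fin normrX;
    by rewrite ler_pXn2r ?nnegrE ?(ltW a0).
move=> /le_trans; apply.
under eq_integral do rewrite gee0_abs ?lee_fin ?sqr_ge0//.
apply: (le_trans (integral_stopped_sum_sqr a n mv)).
rewrite EFinM lee_wpmul2l ?lee_fin//.
rewrite -[leRHS]mule1 -(probability_setT P) -integral_cst//.
apply: ge0_le_integral => //.
- by move=> w _; rewrite lee_fin sumr_ge0// => i _; exact: sqr_ge0.
- apply/measurable_EFinP; apply: measurable_sum => s; apply: measurable_funX.
  exact: sigma_measurable_fun (noise_sub noise_eps (n := s)) (mv s).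
- by move=> w _; rewrite lee_fin.
Qed.

End maximal.

(** * Kronecker's lemma *)

(** With [x] the partial sums of [y s / s.+1%:R], summation by parts writes the quotient as [x n.+1]
    minus the Cesaro mean of [x]; both have the same limit. *)
Lemma kronecker (R : realType) (y : nat -> R) :
  cvgn (fun n => \sum_(s < n) y s / s.+1%:R) ->
  (fun n => (\sum_(s < n.+1) y s) / n.+1%:R) @ \oo --> 0.
Proof.
set x := fun n => \sum_(s < n) _ => /cvg_ex[l xl].
have xE n : \sum_(s < n) y s = n%:R * x n - \sum_(s < n) x s.
  elim: n => [|n IH]; first by rewrite !big_ord0 mul0r subr0.
  have n0 : (n.+1%:R : R) != 0 by rewrite pnatr_eq0.
  by rewrite /x !big_ord_recr/= -/(x n) IH -natr1 in n0 *; field.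
have -> : (fun n => (\sum_(s < n.+1) y s) / n.+1%:R) =
    (fun n => x n.+1 - arithmetic_mean x n).
  apply/funext => n; rewrite xE mulrBl mulrAC divff ?pnatr_eq0// mul1r.
  by rewrite /arithmetic_mean /series /= big_mkord mulrC.
rewrite -(subrr l); apply: cvgB; last exact: cesaro.
by rewrite -(cvg_shiftS x) in xl.
Qed.

(** * Almost sure convergence of the martingale transform *)

Section transform.
Context d (T : measurableType d) (R : realType) (P : probability T R).
Variables (G : nat -> set (set T)) (eps : nat -> T -> R) (e : R).
Hypothesis noise_eps : noise P G eps e.
Variable v : nat -> T -> R.
Hypothesis mv : forall n, measurable_fun [set: g_sigma_algebraType (G n)] (v n).

Let tail_sqr m n w := \sum_(m <= r < n) v r w ^+ 2.
Let tail_sum m n w := \sum_(m <= r < n) v r w * eps r w.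
(* Truncating the weights when the tail energy exceeds [delta] keeps them
   predictable, and changes nothing on the event that it never does. *)
Let localized m (delta : R) n w :=
  if (m <= n)%N && (tail_sqr m n.+1 w <= delta) then v n w else 0.

Let mvT n : measurable_fun [set: T] (v n).
Proof. exact: sigma_measurable_fun (noise_sub noise_eps (n:=n)) (@mv n). Qed.

Let noise_sub_mono m n : (m <= n)%N -> <<s G m >> `<=` <<s G n >>.
Proof.
move=> /subnKC <-; elim: (n - m)%N => [|k IH]; first by rewrite addn0.
rewrite addnS; exact: subset_trans IH (noise_mono noise_eps (n:=(m + k)%N)).
Qed.

Let localized_measurable m (delta : R) n :
  measurable_fun [set: g_sigma_algebraType (G n)] (localized m delta n).
Proof.
rewrite /localized; case: leqP => /= mn; last exact: measurable_cst.
apply: measurable_fun_ifT => //; apply: measurable_fun_ler => //.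
(* [measurable_sum] asks for every summand to be measurable, whatever its index; zeroing those with
   [r > n] keeps all of them measurable at time [n]. *)
have -> : tail_sqr m n.+1 =
    (fun w => \sum_(m <= r < n.+1) if (r <= n)%N then v r w ^+ 2 else 0).
  by apply/funext => w; apply: eq_big_nat => r /andP[_ rn]; rewrite -ltnS rn.
apply: measurable_sum => r; case: leqP => rn; last exact: measurable_cst.
apply: measurable_funX; exact: sub_sigma_measurable_fun (noise_sub_mono rn) _.
Qed.

(** The induction also carries the bound by the tail energy: when the test passes at [n], that
    energy is at most [delta]; when it fails, nothing is added. *)
Let sum_localized_sqr m (delta : R) n w : 0 <= delta ->
  \sum_(s < n) localized m delta s w ^+ 2 <= delta.
Proof.
move=> delta0.
suff [//] : \sum_(s < n) localized m delta s w ^+ 2 <= delta /\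
  \sum_(s < n) localized m delta s w ^+ 2 <= tail_sqr m n w.
elim: n => [|n [IH1 IH2]].
  by rewrite big_ord0; split => //; rewrite /tail_sqr big_geq.
rewrite big_ord_recr/= {2 4}/localized /tail_sqr.
case: ifPn => [/andP[mn h]|].
  suff H : \sum_(s < n) localized m delta s w ^+ 2 + v n w ^+ 2
      <= tail_sqr m n.+1 w by split => //; exact: le_trans H h.
  by rewrite /tail_sqr big_nat_recr//= lerD2r.
rewrite expr0n addr0 => _; split => //; apply: (le_trans IH2).
rewrite /tail_sqr; case: (leqP m n) => mn.
  by rewrite [leRHS]big_nat_recr//= lerDl sqr_ge0.
by rewrite !big_geq// ltnW.
Qed.

Let sum_localized m (delta : R) n w : (forall k, tail_sqr m k w <= delta) ->
  \sum_(s < n) localized m delta s w * eps s w = tail_sum m n w.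
Proof.
move=> h; elim: n => [|n IH]; first by rewrite big_ord0 /tail_sum big_geq.
rewrite big_ord_recr/= IH /localized h andbT /tail_sum.
by case: leqP => mn; [rewrite big_nat_recr|rewrite mul0r addr0 !big_geq// ltnW].
Qed.

(** The second clause is the failure of the Cauchy criterion at level [a]. It does not involve [m],
    which enters only through the energy bound. *)
Let oscillating m (delta a : R) := [set w | (forall k, tail_sqr m k w <= delta) /\
  forall m', exists2 n, (m' <= n)%N & a <= `|tail_sum m' n w|].

Let tail_sum_measurable m n : measurable_fun [set: T] (tail_sum m n).
Proof.
apply: measurable_sum => r; apply: measurable_funM => //.
apply: sigma_measurable_fun (noise_sub noise_eps (n:=r.+1)) _.
exact: noise_measurable noise_eps _.
Qed.

Let oscillating_measurable m (delta a : R) : measurable (oscillating m delta a).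
Proof.
have -> : oscillating m delta a =
    (\bigcap_k [set w | tail_sqr m k w <= delta]) `&`
    \bigcap_m' \bigcup_(n in [set n | (m' <= n)%N])
      [set w | a <= `|tail_sum m' n w|].
  apply/seteqP; split => w /= [h1 h2]; split.
  - by move=> k _; exact: h1.
  - by move=> m' _; have [n mn an] := h2 m'; exists n.
  - by move=> k; exact: h1.
  - by move=> m'; have [n mn an] := h2 m' I; exists n.
apply: measurableI.
  apply: bigcapT_measurable => k; rewrite -[X in measurable X]setTI.
  apply: measurable_fun_le => //; apply: measurable_sum => r.
  exact: measurable_funX.
apply: bigcapT_measurable => m'; apply: bigcup_measurable => n _.
rewrite -[X in measurable X]setTI; apply: measurable_fun_le => //.
exact: measurableT_comp.
Qed.

(** On this event the localized sums are the tail sums from [m], and the second clause at [m' := m]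
    makes them reach [a]; the maximal inequality applies. *)
Let oscillating_le m (delta a : R) : 0 <= delta -> 0 < a ->
  (P (oscillating m delta a) <= (e * delta / a ^+ 2)%:E)%E.
Proof.
move=> delta0 a0.
have := noise_maximal_inequality noise_eps (localized_measurable m delta)
  (fun n w => sum_localized_sqr m n w delta0) a0.
apply: le_trans; apply: le_measure.
- by rewrite inE; exact: oscillating_measurable.
- rewrite inE (_ : [set w | _] = \bigcup_n [set w |
    a <= `|\sum_(s < n) localized m delta s w * eps s w|]); last first.
    by apply/seteqP; split => w /= [n]; [exists n|move=> _; exists n].
  apply: bigcupT_measurable => n; rewrite -[X in measurable X]setTI.
  apply: measurable_fun_le => //; apply: measurableT_comp => //.
  apply: measurable_sum => r; apply: measurable_funM.
    exact: sigma_measurable_fun (noise_sub noise_eps (n:=r))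
      (localized_measurable m delta (n:=r)).
  apply: sigma_measurable_fun (noise_sub noise_eps (n:=r.+1)) _.
  exact: noise_measurable noise_eps _.
- move=> w [h1 h2] /=; have [n _ an] := h2 m; exists n.
  by rewrite sum_localized.
Qed.

(** Starting later only decreases the tail energy. *)
Let oscillating_nd (delta a : R) : nondecreasing_seq (fun m => oscillating m delta a).
Proof.
move=> m n mn; apply/subsetPset => w [h1 h2]; split => // k.
apply: le_trans (h1 k); rewrite /tail_sqr.
have [nk|kn] := leqP n k; last first.
  by rewrite big_geq ?(ltnW kn)// sumr_ge0// => i _; exact: sqr_ge0.
by rewrite (big_cat_nat mn nk)/= lerDr sumr_ge0// => i _; exact: sqr_ge0.
Qed.

(** Bounded nondecreasing energies converge, and a tail is at most the gap between the limit and the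
    partial sum at [m]. *)
Let tail_sqr_small w (B delta : R) : 0 < delta ->
  (forall n, \sum_(s < n) v s w ^+ 2 <= B) ->
  exists m, forall k, tail_sqr m k w <= delta.
Proof.
move=> delta0 hB; pose u n := \sum_(s < n) v s w ^+ 2.
have uE m k : (m <= k)%N -> u k = u m + tail_sqr m k w.
  move=> mk.
  by rewrite /u -!(big_mkord xpredT (fun s => v s w ^+ 2)) (big_cat_nat _ mk).
have ndu : nondecreasing_seq u.
  by move=> m k mk; rewrite (uE _ _ mk) lerDl sumr_ge0// => i _; exact: sqr_ge0.
have cvu : cvgn u.
  by apply: nondecreasing_is_cvgn => //; exists B => _ [n _ <-]; exact: hB.
have /cvgrPdist_le /(_ _ delta0)[m _ hm] := cvu.
exists m => k; have [mk|km] := leqP m k; last first.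
  by rewrite /tail_sqr big_geq ?(ltnW km)// ltW.
have := hm m (leqnn m); have := nondecreasing_cvgn_le ndu cvu k.
have := uE _ _ mk => /= -> /= h1 /(le_trans (ler_norm _)).
by rewrite lerBlDr => h2; have := le_trans h1 h2; rewrite addrC lerD2r.
Qed.

(** If the energy is finite but the series diverges, some level [1/(j+1)] is exceeded by tail sums
    from every starting point, while for each [i] the energy after some [m] is below [1/(i+1)]. For
    fixed [j] this has probability at most a constant over [i+1] for all [i], hence 0. *)
Lemma noise_series_cvg : {ae P, forall w,
  (exists B, forall n, \sum_(s < n) v s w ^+ 2 <= B) ->
  cvgn (fun n => \sum_(s < n) v s w * eps s w)}.
Proof.
pose N j := \bigcap_i \bigcup_m oscillating m i.+1%:R^-1 j.+1%:R^-1.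
have mU i j : measurable (\bigcup_m oscillating m i.+1%:R^-1 j.+1%:R^-1).
  by apply: bigcupT_measurable => m; exact: oscillating_measurable.
have mN j : measurable (N j) by apply: bigcapT_measurable.
have N0 j : P (N j) = 0%E.
  pose C := e / j.+1%:R^-1 ^+ 2.
  have PC i : (P (N j) <= (C * i.+1%:R^-1)%:E)%E.
    apply: (@le_trans _ _ (P (\bigcup_m oscillating m i.+1%:R^-1 j.+1%:R^-1))).
      by apply: le_measure; rewrite ?inE// => w; apply.
    apply: measure_bigcup_le => [m||m].
    - exact: oscillating_measurable.
    - exact: oscillating_nd.
    - by rewrite /C mulrAC; apply: oscillating_le.
  apply/eqP; rewrite -measure_le0.
  have C0 : (fun i => (C * i.+1%:R^-1)%:E) @ \oo --> 0%E.
    apply: cvg_EFin; first exact: nearW.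
    rewrite -[X in _ --> X](mulr0 C); apply: cvgMr; exact: cvg_harmonic.
  rewrite -(cvg_lim _ C0)//; apply: lime_ge; last exact: nearW.
  by apply/cvg_ex; exists 0%E.
exists (\bigcup_j N j); split.
- exact: bigcupT_measurable.
- apply: measure_negligible; first exact: bigcupT_measurable.
  by apply: negligible_bigcup => j; apply/(negligibleP _ (mN j)); exact: N0.
- move=> w /= /not_implyP[[B hB] ncvg].
  suff [a a0 ha] : exists2 a : R, 0 < a &
      forall m', exists2 n, (m' <= n)%N & a <= `|tail_sum m' n w|.
    have [j ja] : exists j, j.+1%:R^-1 < a.
      exists (Num.truncn a^-1); rewrite invf_plt ?posrE//; exact: truncnS_gt.
    exists j => // i _.
    have i0 : 0 < i.+1%:R^-1 :> R by rewrite invr_gt0.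
    have [m hm] := tail_sqr_small i0 hB; exists m => //; split => // m'.
    have [n mn an] := ha m'; exists n => //; exact: le_trans (ltW ja) an.
  (* If no level is exceeded from every starting point, then for each [a] all sums after some [m]
     stay within [a] of the sum at [m], which is the Cauchy criterion. *)
  apply: contrapT => H; apply: ncvg; apply/cauchy_cvgP/cauchy_exP => a a0.
  have [m hm] : exists m, forall n, (m <= n)%N -> `|tail_sum m n w| < a.
    apply: contrapT => H'; apply: H; exists a => // m'.
    apply: contrapT => H''; apply: H'; exists m' => n mn.
    by rewrite ltNge; apply/negP => an; apply: H''; exists n.
  exists (\sum_(s < m) v s w * eps s w); exists m => // n /= mn.
  rewrite -ball_normE /ball_/= distrC.
  rewrite -!(big_mkord xpredT (fun s => v s w * eps s w)) (big_cat_nat _ mn)//=.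
  by rewrite addrAC subrr add0r hm.
Qed.

End transform.

(** * Measurability of inversion and almost surely equal versions *)

(** Inversion is continuous on the open set of nonzero reals, and the remaining point is a
    singleton. *)
Lemma measurable_invr (R : realType) : measurable_fun setT (@GRing.inv R).
Proof.
rewrite -(setvU [set 0]); apply/measurable_funU => //.
  exact: measurableC.
split; last exact: measurable_fun_set1.
apply: open_continuous_measurable_fun.
  exact/closed_openC/closed_eq.
move=> x; rewrite inE /= => /eqP x0; exact: inv_continuous.
Qed.

Lemma measure_ae_eq d (T : measurableType d) (R : realType)
    (mu : {measure set T -> \bar R}) (A B : set T) :
  measurable A -> measurable B -> {ae mu, forall w, A w <-> B w} -> mu A = mu B.
Proof.
move=> mA mB AB; rewrite -[A]setIT -[B]setIT -!integral_indic//.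
apply: ge0_ae_eq_integral => //.
- exact/measurable_EFinP.
- exact/measurable_EFinP.
- apply: filterS AB => w AB _; congr EFin; rewrite !indicE; congr (nat_of_bool _)%:R.
  by apply/idP/idP; rewrite !inE => /AB.
Qed.

(** Carries the noise hypotheses over to an adapted version of the noise. *)
Lemma ae_eq_noise d (T : measurableType d) (R : realType) (P : probability T R)
    (F : set (set T)) (X Y : T -> R) :
  F `<=` @measurable _ T ->
  measurable_fun setT X -> measurable_fun setT Y -> {ae P, forall w, X w = Y w} ->
  [/\ P.-integrable setT (EFin \o X) -> P.-integrable setT (EFin \o Y),
      ('E_P[Y] = 'E_P[X])%E,
      ('E_P[fun w => (Y w ^+ 2)%R] = 'E_P[fun w => (X w ^+ 2)%R])%E &
      indep_of P X F -> indep_of P Y F].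
Proof.
move=> FT mX mY XY; split.
- move=> /integrableP[_ iX]; apply/integrableP; split; first exact/measurable_EFinP.
  rewrite (ge0_ae_eq_integral (g := fun w => `|(X w)%:E|%E))//.
  + by apply: measurableT_comp => //; exact/measurable_EFinP.
  + by apply: measurableT_comp => //; exact/measurable_EFinP.
  + by apply: filterS XY => w /= ->.
- rewrite unlock; apply: ae_eq_integral => //; try exact/measurable_EFinP.
  by apply: filterS XY => w ->.
- rewrite unlock; apply: ge0_ae_eq_integral => //.
  + by apply/measurable_EFinP; exact: measurable_funX.
  + by apply/measurable_EFinP; exact: measurable_funX.
  + by move=> w _; rewrite lee_fin sqr_ge0.
  + by move=> w _; rewrite lee_fin sqr_ge0.
  + by apply: filterS XY => w ->.
- move=> indX A B FA mB.
  have mXB : measurable (X @^-1` B) by rewrite -[X in measurable X]setTI; exact: mX.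
  have mYB : measurable (Y @^-1` B) by rewrite -[X in measurable X]setTI; exact: mY.
  have mA := FT _ FA.
  have -> : P (A `&` Y @^-1` B) = P (A `&` X @^-1` B).
    apply: measure_ae_eq; [exact: measurableI|exact: measurableI|].
    by apply: filterS XY => w /= ->.
  rewrite indX//; congr (_ * _)%E; apply: measure_ae_eq => //.
  by apply: filterS XY => w /= ->.
Qed.

(** * Bounds for inverse squares and for the normalised weights *)

(** Telescoping: [1/(x+1)^2] is at most [1/x - 1/(x+1)]. *)
Lemma sum_invr_sqr_le (R : realType) n : \sum_(s < n) (s.+1%:R ^- 2 : R) <= 2.
Proof.
suff : \sum_(s < n) (s.+1%:R ^- 2 : R) <= 2 - n%:R^-1.
  by move=> /le_trans; apply; rewrite gerBl invr_ge0.
(* Since [0^-1 = 0], the step from 0 to 1 does not telescope and is done by hand. *)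
elim: n => [|[|n] IH]; first by rewrite big_ord0 invr0 subr0.
  by rewrite big_ord_recr big_ord0 /= add0r expr1n invr1; lra.
rewrite big_ord_recr/=; apply: (le_trans (lerD IH (lexx _))).
rewrite -addrA lerD2l lerNr opprD opprK -(natr1 n.+1).
set x : R := n.+1%:R; have x0 : 0 < x by rewrite ltr0n.
rewrite -subr_ge0.
have -> : x^-1 - (x + 1) ^- 2 - (x + 1)^-1 = (x * (x + 1) ^+ 2)^-1.
  by field; rewrite !gt_eqF// addr_gt0.
by rewrite invr_ge0 mulr_ge0 ?sqr_ge0 ?(ltW x0).
Qed.

Section sigma_of.
Context (R : realType) (f : R -> R) (c g : R).
Hypotheses (c0 : 0 < c) (s0 : sigma_of f c g != 0).

Let sigma_cases : sigma_of f c g = c \/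
  0 < sigma_of f c g /\ sigma_of f c g = `|f g|.
Proof.
move: s0; rewrite /sigma_of; case: ifPn => _; last by left.
rewrite /Num.min; case: ifPn => [_|_ fg0]; first by left.
by right; split => //; rewrite lt_neqAle eq_sym fg0 normr_ge0.
Qed.

(** If [sigma_of] is [c], the ratio is controlled by [b / c]; if it is [|f g|], the squared ratio is
    exactly 1. *)
Lemma sqr_sigma_of_le b : `|f g| <= `|b| ->
  ((sigma_of f c g)^-1 * f g) ^+ 2 <= 1 + (c^-1 * b) ^+ 2.
Proof.
move=> fb; case: sigma_cases => [->|[/[swap] ->]].
  rewrite !exprMn (@le_trans _ _ (c^-1 ^+ 2 * b ^+ 2))//; last by rewrite lerDr.
  rewrite ler_wpM2l ?sqr_ge0// -[leLHS]real_normK ?num_real//.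
  by rewrite -[leRHS]real_normK ?num_real// lerXn2r ?nnegrE.
rewrite normr_gt0 => fg0.
by rewrite exprMn exprVn real_normK ?num_real// mulVf ?expf_neq0// lerDl sqr_ge0.
Qed.

(** For [g != 0], [sigma_of] is a minimum, hence at most [|f g|]. *)
Lemma sqr_sigma_of_ge1 : g != 0 -> 1 <= ((sigma_of f c g)^-1 * f g) ^+ 2.
Proof.
move=> g0.
have sgt0 : 0 < sigma_of f c g by case: sigma_cases => [->|[]].
have sle : sigma_of f c g <= `|f g| by rewrite /sigma_of g0 ge_min lexx orbT.
rewrite -[leRHS]real_normK ?num_real// exprn_ege1// normrM normfV.
by rewrite (gtr0_norm sgt0) mulrC ler_pdivlMr// mul1r.
Qed.

End sigma_of.

Lemma cvg0_divSn (R : realType) (x : nat -> R) :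
  (fun n => x n / n%:R) @ \oo --> 0 -> (fun n => x n / n.+1%:R) @ \oo --> 0.
Proof.
move=> /cvgrPdist_le x0; apply/cvgrPdist_le => a /x0[N _ hN].
(* The threshold [N.+1] excludes [n = 0], where [x 0 / 0] is 0 and bounds nothing. *)
exists N.+1 => // -[|n] //= Nn; have := hN n.+1 (ltnW Nn).
rewrite /= !sub0r !normrN !normrM !normfV; apply: le_trans.
by rewrite ler_wpM2l// !normr_nat lef_pV2 ?posrE// ler_nat.
Qed.

(** * Pathwise convergence of the estimator *)

Section estimator.
Context (R : realType) (f : R -> R) (gam : R) (th g sig k k' eps : nat -> R).
Let u s := (sig s)^-1 * f (g s).
Hypotheses (sig0 : forall t, sig t != 0)
  (rec : forall t, th t.+1 = th t - gam * f (g t) + sig t * eps t)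
  (den0 : forall t, k t + \sum_(s < t.+1) u s ^+ 2 != 0)
  (k_small : (fun t => k t / t%:R) @ \oo --> 0)
  (k'_small : (fun t => k' t / t%:R) @ \oo --> 0)
  (noise_small : (fun t => (\sum_(s < t.+1) u s * eps s) / t.+1%:R) @ \oo --> 0)
  (u_ge1 : exists t0, forall t, (t0 <= t)%N -> 1 <= u t ^+ 2).

Let err t := (k' t - gam * k t - \sum_(s < t.+1) u s * eps s) / t.+1%:R.
Let den t := (k t + \sum_(s < t.+1) u s ^+ 2) / t.+1%:R.

Let gamma_hatE t : gamma_hat f th g sig k k' t = gam + err t / den t.
Proof.
have num : \sum_(s < t.+1) (sig s ^- 2 * f (g s) * (th s.+1 - th s)) =
    \sum_(s < t.+1) u s * eps s - gam * \sum_(s < t.+1) u s ^+ 2.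
  rewrite mulr_sumr -sumrB; apply: eq_bigr => s _; rewrite rec /u.
  by field; exact: sig0.
rewrite /gamma_hat num /err /den; have := den0 t.
have : (t.+1%:R : R) != 0 by rewrite pnatr_eq0.
rewrite -/(u _); set S := \sum_(s < t.+1) _ ^+ 2 => t0 S0.
by field; rewrite nat1r t0 S0.
Qed.

Let err_small : err @ \oo --> 0.
Proof.
have -> : err = (fun t => k' t / t.+1%:R - gam * (k t / t.+1%:R)
    - (\sum_(s < t.+1) u s * eps s) / t.+1%:R).
  by apply/funext => t; rewrite /err !mulrBl mulrA.
have gk : (fun t => gam * (k t / t.+1%:R)) @ \oo --> gam * 0.
  by apply: cvgMr; exact: cvg0_divSn.
have := cvgB (cvgB (cvg0_divSn k'_small) gk) noise_small.
by rewrite mulr0 !subr0; apply.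
Qed.

(** At most [t0] of the squares are below 1, so the normalised sum is at least [1 - t0/(t+1)]; the
    corrections from [t0] and [k] vanish and are eventually at least [-1/2]. *)
Let den_ge : \forall t \near \oo, 2^-1 <= den t.
Proof.
have [t0 ht0] := u_ge1.
have sum_ge t : t.+1%:R - t0%:R <= \sum_(s < t.+1) u s ^+ 2.
  elim: t.+1 => [|n IH]; first by rewrite big_ord0 sub0r oppr_le0.
  rewrite big_ord_recr/=; have [tn|nt] := leqP t0 n.
    by rewrite -natr1; have := ht0 _ tn; lra.
  apply: (@le_trans _ _ 0); first by rewrite subr_le0 ler_nat.
  by rewrite addr_ge0 ?sqr_ge0// sumr_ge0// => i _; exact: sqr_ge0.
have small : (fun t => k t / t.+1%:R - t0%:R * t.+1%:R^-1) @ \oo --> 0.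
  have t0h : (fun t => t0%:R * (t.+1%:R : R)^-1) @ \oo --> t0%:R * (0 : R).
    by apply: cvgMr; exact: cvg_harmonic.
  by have := cvgB (cvg0_divSn k_small) t0h; rewrite mulr0 subr0; apply.
have h2 : (0 : R) < 2^-1 by rewrite invr_gt0.
move/cvgrPdist_le : small => /(_ _ h2); apply: filterS => t.
rewrite sub0r normrN => /ler_normlP[+ _] => h.
have t1 : (0 : R) < t.+1%:R^-1 by rewrite invr_gt0.
have : 1 - t0%:R * t.+1%:R^-1 <= (\sum_(s < t.+1) u s ^+ 2) * t.+1%:R^-1.
  by have := ler_wpM2r (ltW t1) (sum_ge t); rewrite mulrBl divff ?pnatr_eq0.
rewrite /den mulrDl; move: h; set a := t0%:R * _; set b := _ / _; set y := _ * _; lra.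
Qed.

Lemma gamma_hat_cvg : gamma_hat f th g sig k k' @ \oo --> gam.
Proof.
(* An error of at most [a / 2] over a denominator of at least [1/2] is at most [a]. *)
apply/cvgrPdist_le => a a0; have a2 : 0 < a / 2 by rewrite divr_gt0.
have /cvgrPdist_le/(_ _ a2) := err_small.
move: den_ge; apply: filterS2 => t d1 e1.
have d0 : 0 < den t by apply: lt_le_trans d1; rewrite invr_gt0.
rewrite gamma_hatE opprD addrA subrr sub0r normrN normrM normfV (gtr0_norm d0).
rewrite ler_pdivrMr//; move: e1; rewrite sub0r normrN => /le_trans; apply.
by rewrite ler_wpM2l// ltW.
Qed.

End estimator.

Lemma sum_sqr_bounded (R : realType) (u b : nat -> R) (l : R) :
  (forall s, u s ^+ 2 <= 1 + b s ^+ 2) ->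
  (fun n : nat => \sum_(1 <= s < n) (b s / s%:R) ^+ 2) @ \oo --> l ->
  exists B, forall n, \sum_(s < n) (u s / s.+1%:R) ^+ 2 <= B.
Proof.
(* The 2 bounds the sum of inverse squares. The series of limit [l] starts at index 1, so the term
   [b 0] is added separately; the others only shrink when divided by [s.+1] instead of [s]. *)
move=> ub bl; exists (2 + (b 0%N ^+ 2 + l)) => n.
have tail_le m : \sum_(1 <= s < m.+1) (b s / s%:R) ^+ 2 <= l.
  have nd : nondecreasing_seq (fun n : nat => \sum_(1 <= s < n.+1) (b s / s%:R) ^+ 2).
    by apply/nondecreasing_seqP => k; rewrite [leRHS]big_nat_recr//= lerDl sqr_ge0.
  have bl' : (fun n => \sum_(1 <= s < n.+1) (b s / s%:R) ^+ 2) @ \oo --> l.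
    by rewrite (cvg_shiftS (fun n => \sum_(1 <= s < n) (b s / s%:R) ^+ 2)).
  rewrite -(cvg_lim _ bl')//; apply: (nondecreasing_cvgn_le nd).
  by apply/cvg_ex; exists l.
apply: (@le_trans _ _ (\sum_(s < n) (s.+1%:R ^- 2 + (b s / s.+1%:R) ^+ 2))).
  apply: ler_sum => s _; rewrite !exprMn !exprVn.
  rewrite -[X in X + _]mul1r -mulrDl ler_wpM2r// ?invr_ge0 ?sqr_ge0//.
rewrite big_split/= lerD//; first exact: sum_invr_sqr_le.
case: n => [|n].
  by rewrite big_ord0 addr_ge0 ?sqr_ge0//; have := tail_le 0%N; rewrite big_geq.
rewrite big_ord_recl/= divr1 lerD2l; apply: le_trans (tail_le n).
rewrite big_add1/= big_mkord; apply: ler_sum => s _.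
rewrite /bump/= add1n !exprMn ler_wpM2l ?sqr_ge0// !exprVn.
by rewrite lef_pV2 ?posrE ?exprn_gt0// lerXn2r ?nnegrE// ler_nat.
Qed.

(** * The filtration generated by the parameters *)

Section filtration.
Context d (T : measurableType d) (R : realType) (D : finType).
Variable theta : nat -> D -> T -> R.

(** The generators are kept apart from the sigma-algebra [gen_filtration] because
    [g_sigma_algebraType] is built from a generating family. *)
Definition filtration_gen t : set (set T) :=
  \bigcup_(s in [set s : nat | (s <= t)%N]) \bigcup_(i in [set: D])
    preimage_set_system setT (theta s i) (@measurable _ R).

Lemma filtration_gen_mono t : <<s filtration_gen t >> `<=` <<s filtration_gen t.+1 >>.
Proof.
apply: sub_sigma_algebra2 => A [s st iA]; exists s => //=.
exact: leqW.
Qed.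

Lemma filtration_gen_sub t : (forall s i, measurable_fun setT (theta s i)) ->
  <<s filtration_gen t >> `<=` @measurable _ T.
Proof.
move=> mtheta; apply: smallest_sub; first exact: sigma_algebra_measurable.
by move=> A [s _ [i _ [B mB <-]]]; exact: mtheta.
Qed.

Lemma theta_measurable s t i : (s <= t)%N ->
  measurable_fun [set: g_sigma_algebraType (filtration_gen t)] (theta s i).
Proof.
move=> st _ B mB; apply: sub_sigma_algebra; exists s => //; exists i => //.
by exists B.
Qed.

Lemma measurable_wrt_fun t (X : T -> R) :
  measurable_wrt (gen_filtration theta t) X ->
  measurable_fun [set: g_sigma_algebraType (filtration_gen t)] X.
Proof. by move=> mX _ B mB; rewrite setTI; exact: mX. Qed.

End filtration.

Lemma measurable_sigma_of d (T : measurableType d) (R : realType)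
    (f : R -> R) (c g : T -> R) :
  measurable_fun setT f -> measurable_fun setT c -> measurable_fun setT g ->
  measurable_fun setT (fun w => sigma_of f (c w) (g w)).
Proof.
move=> mf mc mg; apply: measurable_fun_ifT => //.
  apply: measurable_neg; exact: measurable_fun_eqr.
apply: measurable_minr => //; apply: measurableT_comp => //.
exact: measurableT_comp.
Qed.

(** * Application to the recursion *)

Theorem theorem1 (R : realType) (dT : measure_display) (T : measurableType dT)
  (P : probability T R) (D : finType)
  (L : (D -> R) -> R) (f : R -> R) (gamma : D -> R)
  (theta eps c b k k' : nat -> D -> T -> R) (e : D -> R) :
  (* L admits first-order partial derivatives *)
  (forall (x : D -> R) (d : D), derivable (fun v : R => L (upd x d v)) (x d) 1) ->
  (* the theta_t(d) are real random variables *)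
  (forall t d, measurable_fun setT (theta t d)) ->
  (* implicit: f and the gradients g_t(d) are (F_t-measurable) random quantities *)
  measurable_fun setT f ->
  (forall t d, measurable_wrt (gen_filtration theta t)
                 (fun w => partial L d (fun d' => theta t d' w))) ->
  (* recursion *)
  (forall d, {ae P, forall w, forall t,
     let g := partial L d (fun d' => theta t d' w) in
     theta t.+1 d w = theta t d w - gamma d * f g
                      + sigma_of f (c t d w) g * eps t.+1 d w}) ->
  (* (i) noise *)
  (forall t d, measurable_fun setT (eps t.+1 d)) ->
  (forall t d, P.-integrable setT (EFin \o eps t.+1 d)) ->
  (forall t d, ('E_P[eps t.+1 d] = 0)%E) ->
  (forall t d, ('E_P[fun w => (eps t.+1 d w ^+ 2)%R] = (e d)%:E)%E) ->
  (forall t d, indep_of P (eps t.+1 d) (gen_filtration theta t)) ->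
  (* (ii) *)
  (forall d, {ae P, forall w, exists t0 : nat, forall t, (t0 <= t)%N ->
     partial L d (fun d' => theta t d' w) != 0}) ->
  (* (iii) c adapted and positive; sigma_t(d) is invertible *)
  (forall t d, measurable_wrt (gen_filtration theta t) (c t d)) ->
  (forall d, {ae P, forall w, forall t, 0 < c t d w}) ->
  (forall d, {ae P, forall w, forall t,
     sigma_of f (c t d w) (partial L d (fun d' => theta t d' w)) != 0}) ->
  (* (iv) *)
  (forall t d, measurable_wrt (gen_filtration theta t) (b t d)) ->
  (forall d, {ae P, forall w, forall t,
     `|f (partial L d (fun d' => theta t d' w))| <= `|b t d w|}) ->
  (forall d, {ae P, forall w, exists l : R,
     (fun n : nat => \sum_(1 <= s < n) ((c s d w)^-1 * b s d w / s%:R) ^+ 2)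
       @ \oo --> l}) ->
  (* (v) *)
  (forall t d, measurable_wrt (gen_filtration theta t) (k t d)) ->
  (forall t d, measurable_wrt (gen_filtration theta t) (k' t d)) ->
  (forall d, {ae P, forall w, forall t,
     k t d w + \sum_(s < t.+1)
        ((sigma_of f (c s d w) (partial L d (fun d' => theta s d' w)))^-1
         * f (partial L d (fun d' => theta s d' w))) ^+ 2 != 0}) ->
  (forall d, {ae P, forall w, (fun t : nat => k' t d w / t%:R) @ \oo --> 0}) ->
  (forall d, {ae P, forall w, (fun t : nat => k t d w / t%:R) @ \oo --> 0}) ->
  (* conclusion *)
  forall d, {ae P, forall w,
    (fun t : nat =>
       gamma_hat f (fun s => theta s d w)
         (fun s => partial L d (fun d' => theta s d' w))
         (fun s => sigma_of f (c s d w) (partial L d (fun d' => theta s d' w)))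
         (fun s => k s d w) (fun s => k' s d w) t)
      @ \oo --> gamma d}.
Proof.
move=> _ mtheta mf mg rec meps ieps Eeps Eeps2 indeps g_neq0 mc c_gt0 sig_neq0.
move=> mb fb bsum mk mk' den_neq0 k'_small k_small d.
pose g t w := partial L d (fun d' => theta t d' w).
pose sig t w := sigma_of f (c t d w) (g t w).
pose u t w := (sig t w)^-1 * f (g t w).
pose G := filtration_gen theta.
(* [eps] is only almost surely adapted; solving the recursion for the noise gives
   a version [eps'] that is adapted everywhere. *)
pose eps' t w := (sig t w)^-1 * (theta t.+1 d w - theta t d w + gamma d * f (g t w)).
have mgG t := measurable_wrt_fun (mg t d).
have mfg t : measurable_fun [set: g_sigma_algebraType (G t)] (f \o g t).
  exact: measurableT_comp (mgG t).
have msigV t : measurable_fun [set: g_sigma_algebraType (G t)] (fun w => (sig t w)^-1).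
  apply: (measurableT_comp (@measurable_invr R)).
  exact: measurable_sigma_of mf (measurable_wrt_fun (mc t d)) (mgG t).
have mu t : measurable_fun [set: g_sigma_algebraType (G t)] (u t).
  exact: measurable_funM.
have GS t (X : T -> R) := @sub_sigma_measurable_fun _ _ _ _ _ X
  (@filtration_gen_mono _ _ _ _ theta t).
have GT t : <<s G t >> `<=` @measurable _ T := filtration_gen_sub mtheta.
have meps' t : measurable_fun [set: g_sigma_algebraType (G t.+1)] (eps' t).
  apply: measurable_funM; first exact: GS.
  apply: measurable_funD; first by apply: measurable_funB; exact: theta_measurable.
  by apply: measurable_funM => //; exact: GS.
have epsE : {ae P, forall w t, eps t.+1 d w = eps' t w}.
  move: (rec d) (sig_neq0 d); apply: filterS2 => w recw sigw t.
  by rewrite /eps' recw -/(g t w) -/(sig t w); field; exact: sigw.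
have epsE' t : {ae P, forall w, eps t.+1 d w = eps' t w}.
  by apply: filterS epsE => w.
have meps'T t := sigma_measurable_fun (GT t.+1) (meps' t).
have noise_eps : noise P G eps' (e d).
  split => t; [exact: GT | exact: filtration_gen_mono | exact: meps' |..];
    have [i E E2 ind] := ae_eq_noise (GT t) (meps t d) (meps'T t) (epsE' t).
  - exact: i.
  - by rewrite E.
  - by rewrite E2.
  - exact: ind (indeps t d).
pose v t w := u t w / t.+1%:R.
have mv t : measurable_fun [set: g_sigma_algebraType (G t)] (v t).
  by apply: measurable_funM => //; exact: mu.
have noise_cvg := noise_series_cvg noise_eps mv.
(* From here on the argument is pathwise, at an outcome outside the null sets of the hypotheses and
   of [noise_cvg]. *)
near=> w.
have sig0 t : sig t w != 0 by move: t; near: w; exact: sig_neq0.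
have c0 t : 0 < c t d w by move: t; near: w; exact: c_gt0.
have [t0 ht0] : exists t0 : nat, forall t, (t0 <= t)%N -> g t w != 0.
  by near: w; exact: g_neq0.
apply: (@gamma_hat_cvg _ _ _ _ _ _ _ _ (eps' ^~ w)) => //.
(* [eps'] was defined by solving the recursion, so it satisfies it wherever [sig] is nonzero. *)
- move=> t; rewrite /eps' mulVKf; last exact: sig0.
  by rewrite -/(g t w); ring.
- by near: w; exact: den_neq0.
- by near: w; exact: k_small.
- by near: w; exact: k'_small.
- apply: (@kronecker _ (fun s => u s w * eps' s w)).
  have -> : (fun n => \sum_(s < n) u s w * eps' s w / s.+1%:R) =
      (fun n => \sum_(s < n) v s w * eps' s w).
    by apply/funext => n; apply: eq_bigr => s _; rewrite /v mulrAC.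
  have : (exists B, forall n, \sum_(s < n) v s w ^+ 2 <= B) ->
      cvgn (fun n => \sum_(s < n) v s w * eps' s w).
    by near: w; exact: noise_cvg.
  apply; have [l bl] : exists l : R,
      (fun n => \sum_(1 <= s < n) ((c s d w)^-1 * b s d w / s%:R) ^+ 2) @ \oo --> l.
    by near: w; exact: bsum.
  apply: (@sum_sqr_bounded _ (u ^~ w) (fun s => (c s d w)^-1 * b s d w) l) => //.
  move=> s; apply: sqr_sigma_of_le; first exact: sig0.
  by move: s; near: w; exact: fb.
- exists t0 => t tt0.
  by apply: sqr_sigma_of_ge1; [exact: c0|exact: sig0|exact: ht0].
Unshelve. all: by end_near. Qed.
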